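(* There exists an absolute constant $c>0$ such that the following holds. Let $0<p\le1$, let $X$ be a finite set, let $n\ge1$ be an integer, and let $\mathcal F\subseteq\binom{X}{n}$ be a family of $n$-element subsets of $X$ satisfying \[ |\mathcal F|\ge p^{-n}\qquad\text{and}\qquad |F\cap F'|\le n/2\quad\text{for all distinct }F,F'\in\mathcal F . \] Then \[ \mathbb E\max_{F\in\mathcal F}|F\cap X_p|\ge c\,n . \]
   Context: $X_p$ denotes the random subset of $X$ containing each element independently with probability $p$. *)

(* Defs.v *)
From mathcomp Require Import all_boot all_order all_algebra.

Set Implicit Arguments.
Unset Strict Implicit.
Unset Printing Implicit Defensive.

Import Order.TTheory GRing.Theory Num.Theory.
Local Open Scope ring_scope.

(* The law of the random subset X_p on the finite set of all subsets of X:
   each x is included independently with probability p, so the probability of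
   the outcome A is a product over the elements x of X. *)
Definition randset_prob (R : realFieldType) (X : finType) (p : R)
    (A : {set X}) : R :=
  \prod_(x : X) (if x \in A then p else 1 - p).

Definition randset_expectation (R : realFieldType) (X : finType) (p : R)
    (f : {set X} -> R) : R :=
  \sum_(A : {set X}) randset_prob p A * f A.

(* The maximum is taken in nat, so it is 0 when the family is empty. *)
Definition max_inter (X : finType) (calF : {set {set X}}) (A : {set X}) : nat :=
  (\max_(F in calF) #|F :&: A|)%N.

Lemma randset_prob_ge0 (R : realFieldType) (X : finType) (p : R)
    (A : {set X}) : 0 <= p <= 1 -> 0 <= randset_prob p A.
Proof.
move=> /andP[p0 p1]; apply: prodr_ge0 => x _.
by case: ifP => _ //; rewrite subr_ge0.
Qed.

Lemma randset_prob_sum1 (R : realFieldType) (X : finType) (p : R) :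
  \sum_(A : {set X}) randset_prob p A = 1.
Proof.
rewrite /randset_prob -(bigA_distr _ _ (fun=> p) (fun=> 1 - p)).
by rewrite big1 // => x _; rewrite /= addrC subrK.
Qed.

(* Main.v *)
(** If p > 1/2, any single member of the family already gives p n. Otherwise let
    W = X_q with q = 2p, and call W bad if it meets every member of the family
    in fewer than n/2 points. If W is bad and F is a member, then F is the only
    member contained in W :|: F, because another one, F', would satisfy
    n = |F'| <= |F' :&: F| + |F' :&: W| < n. The events "Z contains F and no
    other member" are disjoint, and conditioning X_q on containing F gives the
    law of W :|: F; so W :|: F lies in the event of F with probability q^-n
    times that of X_q. Summing over F gives
    P(W bad) <= q^-n / |calF| <= 2^-n, so the expected maximum for X_q is at
    least n/4. Finally X_p is the intersection of X_q with an independent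
    X_(1/2), which costs at most a factor 2. *)
Require Import Defs.
From mathcomp Require Import all_boot all_order all_algebra.
From mathcomp Require Import reals.
From mathcomp Require Import zify ring lra.

Set Implicit Arguments.
Unset Strict Implicit.
Unset Printing Implicit Defensive.

Import Order.TTheory GRing.Theory Num.Theory.
Local Open Scope ring_scope.

Section RandomSubsets.

Variables (R : realFieldType) (X : finType).
Implicit Types (p q a : R) (A B F W Z : {set X}) (f g : {set X} -> R).

(** Independence of the points: distributing the product over [x] gives the sum over all subsets.
    Laws are computed below by writing indicators as such products. *)
Lemma expectation_prod p (b : X -> bool -> R) :
  randset_expectation p (fun A => \prod_x b x (x \in A)) =
  \prod_x (p * b x true + (1 - p) * b x false).
Proof.
rewrite (bigA_distr _ _ (fun x => p * b x true) (fun x => (1 - p) * b x false)).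
apply: eq_bigr => A _; rewrite /randset_prob -big_split.
by apply: eq_bigr => x _; case: (x \in A).
Qed.

Lemma eq_set_prod A B : (A == B)%:R = \prod_x ((x \in A) == (x \in B))%:R :> R.
Proof.
have [->|neqAB] := eqVneq A B; first by rewrite big1 // => x _; rewrite eqxx.
have [x neqx] : exists x, (x \in A) != (x \in B).
  apply/existsP; apply: contraNT neqAB; rewrite negb_exists => /forallP eqAB.
  by apply/eqP/setP => x; apply/eqP; rewrite -[_ == _]negbK.
by rewrite (bigD1 x) //= (negbTE neqx) mul0r.
Qed.

Lemma le_expectation p f g : 0 <= p <= 1 -> (forall A, f A <= g A) ->
  randset_expectation p f <= randset_expectation p g.
Proof.
move=> p01 lefg; apply: ler_sum => A _.
by rewrite ler_wpM2l ?randset_prob_ge0.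
Qed.

Lemma expectation_cst p a : randset_expectation p (fun _ : {set X} => a) = a.
Proof. by rewrite /randset_expectation -mulr_suml randset_prob_sum1 mul1r. Qed.

Lemma expectationZl p a f :
  randset_expectation p (fun A => a * f A) = a * randset_expectation p f.
Proof.
by rewrite /randset_expectation mulr_sumr; apply: eq_bigr => A _; rewrite mulrCA.
Qed.

Lemma expectationZr p a f :
  randset_expectation p (fun A => f A * a) = randset_expectation p f * a.
Proof.
by rewrite /randset_expectation mulr_suml; apply: eq_bigr => A _; rewrite mulrA.
Qed.

Lemma expectation_sum p (I : finType) (P : pred I) (h : I -> {set X} -> R) :
  randset_expectation p (fun A => \sum_(i | P i) h i A) =
  \sum_(i | P i) randset_expectation p (h i).
Proof. by rewrite exchange_big; apply: eq_bigr => A _; rewrite mulr_sumr. Qed.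

Lemma eq_sum_indicator g A : g A = \sum_Z (A == Z)%:R * g Z.
Proof.
rewrite (bigD1 A) //= eqxx mul1r big1 ?addr0 // => Z neqZA.
by rewrite eq_sym (negbTE neqZA) mul0r.
Qed.

(** Change of variables: it reduces an identity for all [g] to comparing the masses at each [Z]. *)
Lemma expectation_comp p (h : {set X} -> {set X}) g :
  randset_expectation p (fun A => g (h A)) =
  \sum_Z randset_expectation p (fun A => (h A == Z)%:R) * g Z.
Proof.
transitivity (randset_expectation p (fun A => \sum_Z (h A == Z)%:R * g Z)).
  by apply: eq_bigr => A _; rewrite -eq_sum_indicator.
by rewrite expectation_sum; apply: eq_bigr => Z _; rewrite expectationZr.
Qed.

Lemma eq_expectation p f g : f =1 g ->
  randset_expectation p f = randset_expectation p g.
Proof. by move=> eqfg; apply: eq_bigr => A _; rewrite eqfg. Qed.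

(** Conditioning on containing [F], multiplied out so that [q = 0] is allowed. The masses at [Z] are
    compared point by point. *)
Lemma expectation_setU q F g :
  randset_expectation q (fun W => g (W :|: F)) * q ^+ #|F| =
  randset_expectation q (fun Z => (F \subset Z)%:R * g Z).
Proof.
rewrite (expectation_comp _ (fun W => W :|: F)) mulr_suml.
apply: eq_bigr => Z _; rewrite mulrAC mulrA; congr (_ * _).
have -> : randset_expectation q (fun W => (W :|: F == Z)%:R) =
    randset_expectation q (fun W =>
      \prod_x ((x \in W) || (x \in F) == (x \in Z))%:R).
  by apply: eq_expectation => W; rewrite eq_set_prod; under eq_bigr do rewrite inE.
rewrite (expectation_prod _ (fun x i => (i || (x \in F) == (x \in Z))%:R)).
have -> : q ^+ #|F| = \prod_x (if x \in F then q else 1).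
  by rewrite -big_mkcond prodr_const.
rewrite -big_split /=; have [sFZ|/subsetPn[x xF xNZ]] := boolP (F \subset Z).
  rewrite mulr1; apply: eq_bigr => x _.
  have := subsetP sFZ x; case: (x \in F) => [->//|_] /=; first ring.
  by case: (x \in Z) => /=; ring.
(* A point of [F] outside [Z] makes both masses vanish. *)
by rewrite (bigD1 x) //= xF (negbTE xNZ) /= mulr0; ring.
Qed.

Lemma expectation_setI q a g :
  randset_expectation q (fun W => randset_expectation a (fun A => g (W :&: A))) =
  randset_expectation (a * q) g.
Proof.
transitivity (randset_expectation q (fun W =>
  \sum_Z randset_expectation a (fun A => (W :&: A == Z)%:R) * g Z)).
  by apply: eq_expectation => W; rewrite (expectation_comp _ (setI W)).
rewrite expectation_sum; apply: eq_bigr => Z _; rewrite expectationZr; congr (_ * _).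
(* [b x i] is the probability that [W :&: A] agrees with [Z] at [x], when [i] tells whether [x] lies
   in [W]. *)
pose b x i := a * ((i == (x \in Z))%:R : R) + (1 - a) * (false == (x \in Z))%:R.
transitivity (randset_expectation q (fun W => \prod_x b x (x \in W))).
  apply: eq_expectation => W; rewrite /b.
  transitivity (randset_expectation a (fun A =>
      \prod_x ((x \in W) && (x \in A) == (x \in Z))%:R)).
    by apply: eq_expectation => A; rewrite eq_set_prod; under eq_bigr do rewrite inE.
  rewrite (expectation_prod _ (fun x i => ((x \in W) && i == (x \in Z))%:R)).
  by apply: eq_bigr => x _; rewrite andbT andbF.
rewrite expectation_prod; apply: eq_bigr => x _; rewrite /b.
by case: (x \in Z) => /=; ring.
Qed.

Lemma expectation_mem p x : randset_expectation p (fun A => (x \in A)%:R) = p.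
Proof.
pose b y i : R := (if y == x then i else true)%:R.
transitivity (randset_expectation p (fun A => \prod_y b y (y \in A))).
  apply: eq_expectation => A; rewrite (bigD1 x) //= /b eqxx big1 ?mulr1 // => y.
  by move/negbTE->.
rewrite expectation_prod (bigD1 x) //= /b eqxx big1 => [|y /negbTE-> /=]; last by ring.
by rewrite /=; ring.
Qed.

Lemma expectation_cardI p B :
  randset_expectation p (fun A => #|B :&: A|%:R) = p * #|B|%:R.
Proof.
transitivity (randset_expectation p (fun A => \sum_(x in B) (x \in A)%:R)).
  apply: eq_expectation => A; rewrite -sum1_card natr_sum.
  rewrite (eq_bigl (fun x => (x \in B) && (x \in A))) => [|x]; last by rewrite inE.
  by rewrite big_mkcondr; apply: eq_bigr => x _; case: (x \in A).
rewrite expectation_sum; under eq_bigr do rewrite expectation_mem.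
by rewrite sumr_const mulr_natr.
Qed.

Variable calF : {set {set X}}.

Lemma leq_max_inter A F : F \in calF -> (#|F :&: A| <= max_inter calF A)%N.
Proof. by move=> FF; rewrite /max_inter (bigD1 F) //= leq_maxl. Qed.

Lemma expectation_max_inter_ge p F : 0 <= p <= 1 -> F \in calF ->
  p * #|F|%:R <= randset_expectation p (fun A => (max_inter calF A)%:R).
Proof.
move=> p01 FF; rewrite -expectation_cardI; apply: le_expectation => // A.
by rewrite ler_nat leq_max_inter.
Qed.

(** For fixed [W], take a member [F] attaining the maximum: on average [F :&: W] keeps a fraction
    [a] of its points, and [F] still competes for [W :&: A]. *)
Lemma expectation_max_inter_thin q a : 0 <= q <= 1 -> 0 <= a <= 1 ->
  a * randset_expectation q (fun A => (max_inter calF A)%:R) <=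
  randset_expectation (a * q) (fun A => (max_inter calF A)%:R).
Proof.
move=> q01 a01; rewrite -expectation_setI -expectationZl.
apply: le_expectation => // W.
(* An empty family has no maximiser, but its maximum is 0 by convention. *)
have [calF0|[F0 F0F]] := set_0Vmem calF.
  rewrite [max_inter calF W]/max_inter calF0 big_set0 mulr0 -(expectation_cst a 0).
  by apply: le_expectation => // A; exact: ler0n.
have calF_gt0 : (0 < #|[in calF]|)%N by rewrite (cardD1 F0) F0F.
have [F FF maxF] := eq_bigmax_cond (fun F : {set X} => #|F :&: W|) calF_gt0.
rewrite /max_inter maxF -expectation_cardI; apply: le_expectation => // A.
by rewrite ler_nat -setIA leq_max_inter.
Qed.

Variable n : nat.
Hypothesis calF_card : forall F, F \in calF -> #|F| = n.
Hypothesis calF_sep : forall F F', F \in calF -> F' \in calF -> F <> F' ->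
  (2 * #|F :&: F'| <= n)%N.

Lemma only_subset_setU W F : (2 * max_inter calF W < n)%N -> F \in calF ->
  [set F' in calF | F' \subset W :|: F] = [set F].
Proof.
move=> badW FF; apply/setP => F'; rewrite !inE.
apply/andP/eqP => [[F'F sF'] | ->]; last by rewrite FF subsetUr.
apply/eqP; apply: contraTT isT => /eqP neqF.
have := calF_sep F'F FF neqF.
have := leq_max_inter W F'F.
have : (n <= #|F' :&: W| + #|F' :&: F|)%N.
  by rewrite -(calF_card F'F) -{1}(setIidPl sF') setIUr cardsU leq_subr.
by move: badW; clear; lia.
Qed.

Lemma prob_small_max_inter q : 0 <= q <= 1 ->
  randset_expectation q (fun W => (2 * max_inter calF W < n)%N%:R) *
    (#|calF|%:R * q ^+ n) <= 1.
Proof.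
move=> q01; pose only F Z : R := ([set F' in calF | F' \subset Z] == [set F])%:R.
have le_only F : F \in calF ->
    randset_expectation q (fun W => (2 * max_inter calF W < n)%N%:R) * q ^+ n <=
    randset_expectation q (only F).
  move=> FF; have /andP[q0 _] := q01.
  apply: (@le_trans _ _ (randset_expectation q (fun W => only F (W :|: F)) * q ^+ n)).
    rewrite ler_wpM2r ?exprn_ge0 //; apply: le_expectation => // W.
    rewrite ler_nat; case: ltnP => // badW.
    by rewrite only_subset_setU ?eqxx.
  rewrite -(calF_card FF) expectation_setU; apply: le_expectation => // Z.
  by rewrite ler_piMl ?ler0n // lern1 leq_b1.
rewrite mulrCA mulr_natl -sumr_const.
apply: (@le_trans _ _ (\sum_(F in calF) randset_expectation q (only F))).
  exact: ler_sum le_only.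
rewrite -expectation_sum.
rewrite -[leRHS](expectation_cst q 1); apply: le_expectation => // Z.
rewrite -natr_sum lern1.
have -> : (\sum_(F in calF) ([set F' in calF | F' \subset Z] == [set F]) =
    #|[set F in calF | [set F' in calF | F' \subset Z] == [set F]]|)%N.
  by rewrite -sum1dep_card big_mkcondr; apply: eq_bigr => F _; case: eqP.
(* Disjointness: the members inside [Z] form one set, which equals [[set F]] for at most one [F]. *)
apply/card_le1_eqP => F1 F2; rewrite !inE => /andP[_ /eqP->] /andP[_ /eqP eqF].
by rewrite (set1_inj eqF).
Qed.

Lemma expectation_max_inter_ge_quarter q : 0 <= q <= 1 ->
  2 <= #|calF|%:R * q ^+ n ->
  n%:R / 4 <= randset_expectation q (fun A => (max_inter calF A)%:R).
Proof.
move=> q01 calF_large; have bad1 := prob_small_max_inter q01.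
set P := randset_expectation q _ in bad1.
have P0 : 0 <= P.
  by rewrite -(expectation_cst q 0); apply: le_expectation => // A; exact: ler0n.
have P_half : P <= 1 / 2 by nra.
(* Pointwise, the maximum is at least [n / 2] times one minus the indicator of bad; with
   [P <= 1 / 2] this averages to at least [n / 4]. *)
apply: (@le_trans _ _ (n%:R / 2 + - (n%:R / 2) * P)).
  by have : 0 <= n%:R :> R; [exact: ler0n | nra].
rewrite -expectationZl -[X in X + _](expectation_cst q) /randset_expectation.
rewrite -big_split /=; apply: ler_sum => A _; rewrite -mulrDr.
apply: ler_wpM2l; first exact: randset_prob_ge0.
case: ltnP => [_|n_le]; first by have := ler0n R (max_inter calF A); rewrite /=; lra.
by move: n_le; rewrite mulr0 addr0 -(ler_nat R) natrM; lra.
Qed.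

End RandomSubsets.

Theorem corollary1p12 (R : realType) :
  exists c : R, 0 < c /\
    forall (p : R) (X : finType) (n : nat) (calF : {set {set X}}),
      0 < p -> p <= 1 ->
      (1 <= n)%N ->
      (forall F : {set X}, F \in calF -> #|F| = n) ->
      p ^- n <= #|calF|%:R ->
      (forall F F' : {set X}, F \in calF -> F' \in calF -> F <> F' ->
         #|F :&: F'|%:R <= n%:R / 2 :> R) ->
      c * n%:R <= randset_expectation p (fun A => (max_inter calF A)%:R).
Proof.
(* 1/8 is the bound 1/4 for [2 * p] times the thinning factor 1/2. *)
exists (1 / 8); split=> [|p X n calF p0 p1 n1 cardF calF_large sepF]; first by lra.
have n0 : 0 <= n%:R :> R by exact: ler0n.
have pn : 1 <= #|calF|%:R * p ^+ n.
  by rewrite -ler_pdivrMr ?exprn_gt0 // div1r.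
(* The split ensures that [2 * p] is a probability. *)
have [p_half|p_half] := lerP p (1 / 2); last first.
  have [calF0|[F FF]] := set_0Vmem calF.
    by move: pn; rewrite calF0 cards0 mul0r ler10.
  have p01 : 0 <= p <= 1 by rewrite ltW.
  apply: le_trans (expectation_max_inter_ge p01 FF).
  by rewrite (cardF F FF); nra.
have sepN F F' : F \in calF -> F' \in calF -> F <> F' -> (2 * #|F :&: F'| <= n)%N.
  by move=> FF F'F neq; have := sepF F F' FF F'F neq; rewrite -(ler_nat R) natrM; lra.
have q01 : 0 <= 2 * p <= 1 by lra.
have := expectation_max_inter_ge_quarter cardF sepN q01.
(* Doubling [p] gains [2 ^+ n], which is at least 2 because [n] is positive. *)
have -> : 2 <= #|calF|%:R * (2 * p) ^+ n.
  rewrite exprMn mulrCA; apply: (@le_trans _ _ (2 ^+ n)); first by rewrite ler_eXnr ?ler1n.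
  by rewrite ler_peMr ?exprn_ge0.
move=> /(_ isT) quarter.
have a01 : 0 <= (1 / 2 : R) <= 1 by lra.
have := expectation_max_inter_thin calF q01 a01.
have -> : 1 / 2 * (2 * p) = p by field.
by move: quarter; lra.
Qed.
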